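(* Let $N\ge 2$, let $F(\cdot,t):\mathbb{R}^n\times\mathbb{R}^n\rightrightarrows\mathbb{R}^n$ ($t=0,\dots,N-2$) be convex set-valued mappings, $Q_0,Q_1\subseteq\mathbb{R}^n$ nonempty convex sets, and $\varphi:\mathbb{R}^{2n}\to\mathbb{R}\cup\{+\infty\}$ a proper convex function. Let $\alpha$ be the optimal value of the problem $(P_D)$: minimize $\varphi(x_{N-1},x_N)$ subject to $x_{t+2}\in F(x_t,x_{t+1},t)$, $t=0,\dots,N-2$, $x_0\in Q_0$, $x_1\in Q_1$; and let $\alpha^*$ be the optimal value of the dual problem $$(P_D^* )\quad \sup_{\substack{x_t^*,\,x_N^*,\,\mu_t^*\\ t=0,\dots,N-1}}\Big\{-\varphi^*(\mu_{N-1}^*-x_{N-1}^*,-x_N^* )+\sum_{t=0}^{N-2}M_{F(\cdot,t)}(x_t^*-\mu_t^*,\mu_{t+1}^*,x_{t+2}^* )-W_{Q_0}(x_0^*-\mu_0^* )-W_{Q_1}(x_1^* )\Big\},$$ the supremum being over vectors in $\mathbb{R}^n$. Then $\alpha\ge\alpha^*$ (for all feasible solutions of the primary problem $(P_D)$ and the dual problem $(P_D^* )$, the primal objective value is at least the dual objective value). Besides, if the nondegeneracy condition is satisfied, then the existence of a solution to one of these problems implies the existence of a solution to the other, where $\alpha=\alpha^*$, and in the case $\alpha>-\infty$ the dual problem $(P_D^* )$ has a solution.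
   Context: A set-valued mapping $G:\mathbb{R}^{2n}\rightrightarrows\mathbb{R}^n$ is convex if $\mathrm{gph}\,G=\{(x,y,z): z\in G(x,y)\}$ is convex. Notation: - $\varphi^*(x^*,y^* )=\sup_{x,y}\{\langle x,x^*\rangle+\langle y,y^*\rangle-\varphi(x,y)\}$ is the conjugate function; - $M_G(x^*,y^*,z^* )=\inf\{\langle x,x^*\rangle+\langle y,y^*\rangle-\langle z,z^*\rangle:(x,y,z)\in\mathrm{gph}\,G\}$; - $W_A(x^* )=\sup_{x\in A}\langle x,x^*\rangle$ is the support function of $A$. Nondegeneracy condition: there are points $x_t\in\mathbb{R}^n$, $t=0,\dots,N$, such that one of the following holds: (1) $(x_t,x_{t+1},x_{t+2})\in\mathrm{ri}\,\mathrm{gph}\,F(\cdot,t)$, $t=0,\dots,N-2$, $x_0\in\mathrm{ri}\,Q_0$, $x_1\in\mathrm{ri}\,Q_1$, $(x_{N-1},x_N)\in\mathrm{ri}\,\mathrm{dom}\,\varphi$; (2) $(x_t,x_{t+1},x_{t+2})\in\mathrm{int}\,\mathrm{gph}\,F(\cdot,t)$, $t=0,\dots,N-2$, $x_0\in\mathrm{int}\,Q_0$, $x_1\in\mathrm{int}\,Q_1$ (with the possible exception of one fixed $t$, for which only membership in the set itself is required), and $\varphi$ is continuous at $(x_{N-1},x_N)$. Here $\mathrm{ri}$ denotes relative interior, $\mathrm{int}$ interior and $\mathrm{dom}\,\varphi=\{\varphi<+\infty\}$.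
   Formalization: ''Existence of a solution to one implies existence for the other'' is proved as attainment only from primal to dual; conversely only finite α=α* is claimed, since a dual solution need not give a primal one (N=2, n=1, F≡ℝ, Q_0=Q_1=ℝ, φ=exp(x_1)). *)

(* Defs.v *)
From HB Require Import structures.
From mathcomp Require Import all_boot all_order all_algebra.
From mathcomp Require Import all_classical all_reals all_analysis.

Set Implicit Arguments.
Unset Strict Implicit.
Unset Printing Implicit Defensive.

Import Order.TTheory GRing.Theory Num.Theory.
Import numFieldNormedType.Exports.

Local Open Scope classical_set_scope.
Local Open Scope ring_scope.

Definition dot (R : realType) (n : nat) (u v : 'rV[R]_n) : R :=
  \sum_(i < n) u 0 i * v 0 i.

Definition affine_hull (R : realType) (E : normedModType R) (A : set E) :
    set E :=
  [set y | exists (k : nat) (c : 'I_k -> R) (v : 'I_k -> E),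
     [/\ \sum_(i < k) c i = 1, (forall i, A (v i)) &
         y = \sum_(i < k) c i *: v i]].

(* The interior of A for the topology induced on its affine hull. *)
Definition relint (R : realType) (E : normedModType R) (A : set E) : set E :=
  [set x | A x /\ \forall y \near x, affine_hull A y -> A y].

Definition gph (R : realType) (n : nat)
    (G : 'rV[R]_n -> 'rV[R]_n -> set 'rV[R]_n) :
    set ('rV[R]_n * 'rV[R]_n * 'rV[R]_n) :=
  [set p | G p.1.1 p.1.2 p.2].

Definition convex_mapping (R : realType) (n : nat)
    (G : 'rV[R]_n -> 'rV[R]_n -> set 'rV[R]_n) : Prop :=
  convex_set (gph G).

(* Extended-real-valued functions, so the library's [convex_function], which is
   about real-valued ones, does not apply. For proper f both products below are
   > -oo, hence the sum is the usual one. *)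
Definition econvex (R : realType) (E : normedModType R) (f : E -> \bar R) :
    Prop :=
  forall (p q : E) (t : R), 0 < t -> t < 1 ->
    (f (t *: p + (1 - t) *: q)%R <= t%:E * f p + (1 - t)%:E * f q)%E.

Definition eproper (R : realType) (E : Type) (f : E -> \bar R) : Prop :=
  (forall p, f p != -oo%E) /\ (exists p, (f p < +oo)%E).

Definition edom (R : realType) (E : Type) (f : E -> \bar R) : set E :=
  [set p | (f p < +oo)%E].

Definition conjugate (R : realType) (n : nat)
    (f : 'rV[R]_n * 'rV[R]_n -> \bar R) (xs ys : 'rV[R]_n) : \bar R :=
  ereal_sup [set ((dot p.1 xs + dot p.2 ys)%:E - f p)%E
            | p in [set: 'rV[R]_n * 'rV[R]_n]].

Definition M_ (R : realType) (n : nat)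
    (G : 'rV[R]_n -> 'rV[R]_n -> set 'rV[R]_n) (xs ys zs : 'rV[R]_n) : \bar R :=
  ereal_inf [set (dot p.1.1 xs + dot p.1.2 ys - dot p.2 zs)%:E | p in gph G].

Definition W_ (R : realType) (n : nat) (A : set 'rV[R]_n) (xs : 'rV[R]_n) :
    \bar R :=
  ereal_sup [set (dot x xs)%:E | x in A].

(* Trajectories x_0, ..., x_N, and likewise the dual variables x*_0, ..., x*_N
   and mu*_0, ..., mu*_(N-1), are the initial segments of nat-indexed sequences:
   no definition below looks at later terms. Similarly F t is only used for
   t <= N - 2. *)

Definition primal_feasible (R : realType) (n N : nat)
    (F : nat -> 'rV[R]_n -> 'rV[R]_n -> set 'rV[R]_n) (Q0 Q1 : set 'rV[R]_n)
    (x : nat -> 'rV[R]_n) : Prop :=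
  [/\ forall t, (t < N.-1)%N -> F t (x t) (x t.+1) (x t.+2), Q0 (x 0%N) &
      Q1 (x 1%N)].

Definition primal_objective (R : realType) (n N : nat)
    (phi : 'rV[R]_n * 'rV[R]_n -> \bar R) (x : nat -> 'rV[R]_n) : \bar R :=
  phi (x N.-1, x N).

Definition primal_value (R : realType) (n N : nat)
    (F : nat -> 'rV[R]_n -> 'rV[R]_n -> set 'rV[R]_n) (Q0 Q1 : set 'rV[R]_n)
    (phi : 'rV[R]_n * 'rV[R]_n -> \bar R) : \bar R :=
  ereal_inf [set primal_objective N phi x | x in primal_feasible N F Q0 Q1].

Definition primal_solution (R : realType) (n N : nat)
    (F : nat -> 'rV[R]_n -> 'rV[R]_n -> set 'rV[R]_n) (Q0 Q1 : set 'rV[R]_n)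
    (phi : 'rV[R]_n * 'rV[R]_n -> \bar R) (x : nat -> 'rV[R]_n) : Prop :=
  [/\ primal_feasible N F Q0 Q1 x,
      primal_objective N phi x = primal_value N F Q0 Q1 phi &
      primal_value N F Q0 Q1 phi \is a fin_num].

(* If phi is proper and Q0, Q1 are nonempty, a term +oo can only come from M_ of
   a mapping with empty graph, and then the primal problem is infeasible; the
   library convention (+oo) + (-oo) = -oo matters in that case only. *)
Definition dual_objective (R : realType) (n N : nat)
    (F : nat -> 'rV[R]_n -> 'rV[R]_n -> set 'rV[R]_n) (Q0 Q1 : set 'rV[R]_n)
    (phi : 'rV[R]_n * 'rV[R]_n -> \bar R) (xs mus : nat -> 'rV[R]_n) : \bar R :=
  (- conjugate phi (mus N.-1 - xs N.-1)%R (- xs N)%R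
   + \sum_(0 <= t < N.-1) M_ (F t) (xs t - mus t)%R (mus t.+1) (xs t.+2)
   - W_ Q0 (xs 0%N - mus 0%N)%R - W_ Q1 (xs 1%N))%E.

Definition dual_value (R : realType) (n N : nat)
    (F : nat -> 'rV[R]_n -> 'rV[R]_n -> set 'rV[R]_n) (Q0 Q1 : set 'rV[R]_n)
    (phi : 'rV[R]_n * 'rV[R]_n -> \bar R) : \bar R :=
  ereal_sup [set dual_objective N F Q0 Q1 phi d.1 d.2
            | d in [set: (nat -> 'rV[R]_n) * (nat -> 'rV[R]_n)]].

(* Finiteness matters here: when the dual value is -oo, every (xs, mus) attains
   the supremum. *)
Definition dual_solution (R : realType) (n N : nat)
    (F : nat -> 'rV[R]_n -> 'rV[R]_n -> set 'rV[R]_n) (Q0 Q1 : set 'rV[R]_n)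
    (phi : 'rV[R]_n * 'rV[R]_n -> \bar R) (xs mus : nat -> 'rV[R]_n) : Prop :=
  dual_objective N F Q0 Q1 phi xs mus = dual_value N F Q0 Q1 phi /\
  dual_value N F Q0 Q1 phi \is a fin_num.

Definition nondegenerate_ri (R : realType) (n N : nat)
    (F : nat -> 'rV[R]_n -> 'rV[R]_n -> set 'rV[R]_n) (Q0 Q1 : set 'rV[R]_n)
    (phi : 'rV[R]_n * 'rV[R]_n -> \bar R) (x : nat -> 'rV[R]_n) : Prop :=
  [/\ forall t, (t < N.-1)%N -> relint (gph (F t)) (x t, x t.+1, x t.+2),
      relint Q0 (x 0%N), relint Q1 (x 1%N) &
      relint (edom phi) (x N.-1, x N)].

(* The labels of the constraint sets Q0, Q1 and gph F(., t). *)
Inductive constraint := InitialQ0 | InitialQ1 | Graph of nat.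

(* e labels the constraint set exempted from the interior requirement. As is
   usual in convex analysis, phi is continuous at a point where it is finite:
   without the explicit finiteness, phi could be identically +oo near the point
   and continuous there for the topology of \bar R. *)
Definition nondegenerate_int (R : realType) (n N : nat)
    (F : nat -> 'rV[R]_n -> 'rV[R]_n -> set 'rV[R]_n) (Q0 Q1 : set 'rV[R]_n)
    (phi : 'rV[R]_n * 'rV[R]_n -> \bar R) (x : nat -> 'rV[R]_n) : Prop :=
  exists e : constraint,
  [/\ primal_feasible N F Q0 Q1 x,
      forall t, (t < N.-1)%N -> e <> Graph t ->
        interior (gph (F t)) (x t, x t.+1, x t.+2),
      e <> InitialQ0 -> interior Q0 (x 0%N),
      e <> InitialQ1 -> interior Q1 (x 1%N) &
      edom phi (x N.-1, x N) /\ {for (x N.-1, x N), continuous phi}].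

Definition nondegeneracy (R : realType) (n N : nat)
    (F : nat -> 'rV[R]_n -> 'rV[R]_n -> set 'rV[R]_n) (Q0 Q1 : set 'rV[R]_n)
    (phi : 'rV[R]_n * 'rV[R]_n -> \bar R) : Prop :=
  exists x : nat -> 'rV[R]_n,
    nondegenerate_ri N F Q0 Q1 phi x \/ nondegenerate_int N F Q0 Q1 phi x.

(* Main.v *)
Require Import Defs.
From mathcomp Require Import all_boot all_order all_algebra.
From mathcomp Require Import all_classical all_reals all_analysis.
From mathcomp Require Import ring lra.
Import Order.TTheory GRing.Theory Num.Theory.
Import numFieldNormedType.Exports.
Local Open Scope classical_set_scope.
Local Open Scope ring_scope.

Set Implicit Arguments.
Unset Strict Implicit.
(** The dual problem is the Lagrange dual of a decoupled form of the primal one.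
Give every occurrence of a state its own copy: [a t] is the first argument of
[F t] (and, for the last two indices, an argument of [phi]), [b t] is the second
argument of [F t], and [c t] is the value produced by [F (t - 2)], or the initial
state when [t] is 0 or 1. The triples [(a, b, c)] that satisfy every set
constraint and make [phi] finite form a convex set ([splitting]), and a feasible
trajectory of finite cost is such a triple satisfying the linear equations
[a t = c t] and [b t = a t.+1]. Let [xs t] and [mus t.+1] be the multipliers of
these equations; the added linear term is [coupling]. Grouped by constraint set
([coupling_blocks]), the Lagrangian is a sum of terms in independent variables,
and its infimum is the dual objective. On a feasible trajectory the linear term
vanishes, which is weak duality ([dual_le_primal]). Conversely, multipliers for
which the Lagrangian is bounded below by [alpha] have dual objective at least
[alpha] ([dual_objective_ge]).

It remains to find such multipliers when [alpha] is finite. They are found one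
scalar equation at a time ([one_multiplier], [multipliers]): dropping the equation
[g w = 0] costs a multiple of [g], whose coefficient is a number squeezed between
slopes of the objective on the two sides of the hyperplane. The squeezing needs
points on both sides, or on neither, hence the qualification used: for each [d] of
the domain there are [e > 0] and [d'] in the domain with [g d' = - e * g d] for all
the equations, that is, [d' + e d] satisfies them. Both forms of the nondegeneracy
condition give this ([slater_direction]) by moving from the nondegenerate
trajectory [x] to [d' = x + e (z - d)], where [z] is a trajectory. Under relative
interiority take [z = x], since the ray from [d] through [x] stays in the affine
hull. Under interiority every direction is allowed in every set but one, and [z] is
chosen to agree with [d] in that one, so that the corresponding component of [x]
does not move at all. *)

(** * Lagrange multipliers for linear equations *)

Lemma scalar_comb (R : realType) (E : lmodType R) (g : E -> R) :
  scalar g ->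
  forall a b p q, g (a *: p + b *: q) = a * g p + b * g q.
Proof.
move=> gL a b p q; have g0 : g 0 = 0.
  by have := gL (-1) 0 0; rewrite scaler0 addr0 mulN1r addNr.
by rewrite gL -[b *: q]addr0 gL g0 addr0.
Qed.

Definition convex_on (R : realType) (E : lmodType R) (D : set E) (f : E -> R) :=
  forall p q (t : R), D p -> D q -> 0 < t -> t < 1 ->
    D (t *: p + (1 - t) *: q) /\
    f (t *: p + (1 - t) *: q) <= t * f p + (1 - t) * f q.

(** Seen from the hyperplane [g = 0], every slope [(f - alpha) / g] on the negative
side is at most every such slope on the positive side: join the two points and use
[alpha <= f] where the segment crosses the hyperplane. Minus the supremum of the
slopes on the negative side is then a multiplier. The third hypothesis makes one
side empty as soon as the other is; without it that supremum could be infinite. *)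
Lemma one_multiplier (R : realType) (E : lmodType R) (D : set E) (f g : E -> R)
    (alpha : R) :
  scalar g -> convex_on D f ->
  (forall d, D d -> exists (e : R) d', [/\ 0 < e, D d' & g d' = - e * g d]) ->
  (forall w, D w -> g w = 0 -> alpha <= f w) ->
  exists c, forall w, D w -> alpha <= f w + c * g w.
Proof.
move=> gL fD cq f_ge.
have cross w z : D w -> D z -> g w < 0 -> 0 < g z ->
    (f w - alpha) / g w <= (f z - alpha) / g z.
  move=> Dw Dz gw gz.
  (* The weight for which the combination of w and z lies on g = 0. *)
  set t := g z / (g z - g w).
  have gzw : 0 < g z - g w by lra.
  have t0 : 0 < t by rewrite divr_gt0.
  have t1 : t < 1 by rewrite ltr_pdivrMr// mul1r; lra.
  have [Dm fm] := fD w z t Dw Dz t0 t1.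
  have gm : g (t *: w + (1 - t) *: z) = 0.
    by rewrite (scalar_comb gL) /t; field; lra.
  have := le_trans (f_ge _ Dm gm) fm => {fm} fm.
  have {}fm : 0 <= g z * (f w - alpha) - g w * (f z - alpha).
    have : 0 <= (g z - g w) * (t * f w + (1 - t) * f z - alpha).
      by apply: mulr_ge0; [exact: ltW | rewrite subr_ge0].
    suff -> : (g z - g w) * (t * f w + (1 - t) * f z - alpha) =
      g z * (f w - alpha) - g w * (f z - alpha) by [].
    by rewrite /t; field; lra.
  rewrite ler_pdivlMr// mulrAC ler_ndivrMr//.
  lra.
pose S := [set (f w - alpha) / g w | w in [set w | D w /\ g w < 0]].
have [S0|/set0P[_ [w0 [Dw0 gw0] _]]] := eqVneq S set0.
  have no w : D w -> ~ (g w < 0).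
    move=> Dw gw; have : S ((f w - alpha) / g w) by exists w.
    by rewrite S0.
  exists 0 => w Dw; rewrite mul0r addr0; apply: f_ge => //.
  apply/eqP; rewrite eq_le !leNgt; apply/andP; split; apply/negP.
    move=> gw; have [e [d [e0 Dd gd]]] := cq w Dw.
    by apply: (no d Dd); rewrite gd mulNr oppr_lt0 mulr_gt0.
  exact: no.
have [z [Dz gz]] : exists z, D z /\ 0 < g z.
  have [e [d [e0 Dd gd]]] := cq _ Dw0.
  by exists d; split=> //; rewrite gd nmulr_rgt0 ?oppr_lt0.
have ubS z' : D z' -> 0 < g z' -> ubound S ((f z' - alpha) / g z').
  by move=> Dz' gz' _ [w [Dw gw] <-]; exact: cross.
have supS : has_sup S.
  by split; [exists ((f w0 - alpha) / g w0), w0 | exists ((f z - alpha) / g z);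
     exact: ubS].
exists (- sup S) => w Dw; have [gw|gw|gw] := ltgtP (g w) 0.
- have : (f w - alpha) / g w <= sup S by apply: sup_upper_bound => //; exists w.
  by rewrite ler_ndivrMr//; lra.
- have : sup S <= (f w - alpha) / g w.
    by apply: ge_sup; [exact: supS.1 | exact: ubS].
  by rewrite ler_pdivlMr//; lra.
- by rewrite gw mulr0 addr0 f_ge.
Qed.

(** Price the first equation on the part of [D] where the others hold, then apply
induction to the priced objective [f + c0 * g i], which is convex on the same
domain; so one qualification serves for all steps. *)
Lemma multipliers (R : realType) (E : lmodType R) (I : eqType) (s : seq I)
    (D : set E) (f : E -> R) (g : I -> E -> R) (alpha : R) :
  uniq s -> (forall i, scalar (g i)) -> convex_on D f ->
  (forall d, D d -> exists (e : R) d',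
    [/\ 0 < e, D d' & forall i, i \in s -> g i d' = - e * g i d]) ->
  (forall w, D w -> (forall i, i \in s -> g i w = 0) -> alpha <= f w) ->
  exists c : I -> R, forall w, D w -> alpha <= f w + \sum_(i <- s) c i * g i w.
Proof.
move=> + gL; elim: s f => [|i s IH] f /= us fD cq f_ge.
  by exists (fun=> 0) => w Dw; rewrite big_nil addr0 f_ge.
move: us => /andP[ins us].
pose D' := D `&` [set w | forall j, j \in s -> g j w = 0].
have fD' : convex_on D' f.
  move=> p q t [Dp gp] [Dq gq] t0 t1; have [Dm fm] := fD p q t Dp Dq t0 t1.
  split=> //; split=> // j js.
  by rewrite (scalar_comb (gL j)) gp// gq// !mulr0 addr0.
have [] := @one_multiplier _ _ D' f (g i) alpha (gL i) fD'.
- move=> d [Dd gd]; have [e [d' [e0 Dd' gd']]] := cq d Dd.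
  exists e, d'; split=> //; last by rewrite gd'// mem_head.
  by split=> // j js; rewrite gd' ?inE ?js ?orbT// gd// mulr0.
- move=> w [Dw gw] giw; apply: f_ge => // j; rewrite inE => /orP[/eqP->//|].
  exact: gw.
move=> c0 fc0.
have [||||c fc] := IH (fun w => f w + c0 * g i w) => //.
- move=> p q t Dp Dq t0 t1; have [Dm fm] := fD p q t Dp Dq t0 t1.
  by split=> //=; rewrite (scalar_comb (gL i)); lra.
- move=> d Dd; have [e [d' [e0 Dd' gd']]] := cq d Dd.
  by exists e, d'; split=> // j js; rewrite gd'// inE js orbT.
- by move=> w Dw gw; apply: fc0.
exists (fun j => if j == i then c0 else c j) => w Dw.
rewrite big_cons eqxx addrA (le_trans (fc w Dw))// lerD2l le_eqVlt.
apply/orP; left; apply/eqP; apply: eq_big_seq => j js.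
by case: eqVneq => // ji; rewrite -ji js in ins.
Qed.
(** * The Lagrangian and its blocks *)

Lemma dotDr (R : realType) (n : nat) (u v w : 'rV[R]_n) :
  dot u (v + w) = dot u v + dot u w.
Proof.
by rewrite /dot -big_split; apply: eq_bigr => i _ /=; rewrite mxE mulrDr.
Qed.

Lemma dotNr (R : realType) (n : nat) (u v : 'rV[R]_n) : dot u (- v) = - dot u v.
Proof.
by rewrite /dot -sumrN; apply: eq_bigr => i _ /=; rewrite mxE mulrN.
Qed.

Lemma dotC (R : realType) (n : nat) (u v : 'rV[R]_n) : dot u v = dot v u.
Proof. by apply: eq_bigr => i _; rewrite mulrC. Qed.

Lemma dotBr (R : realType) (n : nat) (u v w : 'rV[R]_n) :
  dot u (v - w) = dot u v - dot u w.
Proof. by rewrite dotDr dotNr. Qed.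

Lemma dotBl (R : realType) (n : nat) (u v w : 'rV[R]_n) :
  dot (u - v) w = dot u w - dot v w.
Proof. by rewrite dotC dotBr !(dotC w). Qed.

Lemma dot0l (R : realType) (n : nat) (u : 'rV[R]_n) : dot 0 u = 0.
Proof. by rewrite -(subrr u) dotBl subrr. Qed.

(** The linear part of the Lagrangian: [xs t] is the price of [a t = c t] and
[mus t.+1] that of [b t = a t.+1]. *)
Definition coupling (R : realType) (n K : nat)
    (xs mus a b c : nat -> 'rV[R]_n) : R :=
  \sum_(t < K.+2) dot (a t - c t) (xs t) +
  \sum_(t < K) dot (b t - a t.+1) (mus t.+1).

(** Summation by parts, from the equations to the constraint sets. The dual
objective depends on [xs 0] and [mus 0] through their difference only, whence the
correction by [mus 0], which is no multiplier. *)
Lemma coupling_blocks (R : realType) (n K : nat)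
    (xs mus a b c : nat -> 'rV[R]_n) :
  coupling K xs mus a b c - dot (a 0%N - c 0%N) (mus 0%N) =
  dot (a K) (xs K - mus K) + dot (a K.+1) (xs K.+1)
  + \sum_(0 <= t < K) (dot (a t) (xs t - mus t) + dot (b t) (mus t.+1)
                       - dot (c t.+2) (xs t.+2))
  - dot (c 0%N) (xs 0%N - mus 0%N) - dot (c 1%N) (xs 1%N).
Proof.
rewrite big_mkord /coupling; elim: K => [|K IH].
  by rewrite !big_ord_recr !big_ord0 /= !dotBl !dotBr; lra.
rewrite big_ord_recr [in X in _ + X - _]big_ord_recr [in RHS]big_ord_recr /=.
move: IH; rewrite !dotBr !dotBl; lra.
Qed.

Lemma fin_between (R : realType) (l u : R) (x : \bar R) :
  (l%:E <= x)%E -> (x <= u%:E)%E -> exists k, x = k%:E.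
Proof. by case: x => [k _ _||//]; [exists k | rewrite leye_eq]. Qed.

(** The infimum of a sum of functions of independent variables is the sum of the
infima. Having also a real value for that sum keeps the rest of the argument away
from undefined differences of infinities. *)
Lemma sum_ereal_inf_ge (R : realType) (I : eqType) (T : Type) (s : seq I)
    (G : I -> set T) (h : I -> T -> R) (p0 : I -> T) (gamma : R) :
  uniq s -> (forall i, i \in s -> G i (p0 i)) ->
  (forall p : I -> T, (forall i, i \in s -> G i (p i)) ->
    gamma <= \sum_(i <- s) h i (p i)) ->
  exists2 m, (\sum_(i <- s) ereal_inf [set (h i p)%:E | p in G i])%E = m%:E &
    gamma <= m.
Proof.
elim: s gamma => [|i s IH] gamma /= us G0 h_ge.
  by exists 0; [rewrite big_nil | have := h_ge p0 G0; rewrite big_nil].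
move: us => /andP[ins us].
have G0s j : j \in s -> G j (p0 j) by move=> js; apply: G0; rewrite inE js orbT.
have h_ge_head a : G i a -> exists2 m,
    (\sum_(j <- s) ereal_inf [set (h j p)%:E | p in G j])%E = m%:E &
    gamma - h i a <= m.
  move=> Ga; apply: IH => // p Gp.
  have := h_ge (fun j => if j == i then a else p j).
  rewrite big_cons eqxx addrC -lerBlDr => le_h; rewrite (le_trans (le_h _))//.
    by move=> j; rewrite inE; case: eqVneq => [->//|_] /=; exact: Gp.
  rewrite le_eqVlt; apply/orP; left; apply/eqP; apply: eq_big_seq => j js.
  by case: eqVneq => // ji; rewrite -ji js in ins.
have Gi0 : G i (p0 i) by apply: G0; rewrite mem_head.
have [m sm _] := h_ge_head _ Gi0.
have inf_ge : ((gamma - m)%:E <= ereal_inf [set (h i p)%:E | p in G i])%E.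
  apply: le_ereal_inf_tmp => _ [a Ga <-]; have [m' ] := h_ge_head a Ga.
  by rewrite sm => -[<-] le_m; rewrite lee_fin; lra.
have [k infk] : exists k, ereal_inf [set (h i p)%:E | p in G i] = k%:E.
  by apply: (fin_between inf_ge (u := h i (p0 i))); apply: ereal_inf_lbound;
     exists (p0 i).
exists (k + m); first by rewrite big_cons infk sm.
by move: inf_ge; rewrite infk lee_fin; lra.
Qed.

(** * Bounds on the dual objective *)

Lemma dual_le_primal (R : realType) (n K : nat)
    (F : nat -> 'rV[R]_n -> 'rV[R]_n -> set 'rV[R]_n) (Q0 Q1 : set 'rV[R]_n)
    (phi : 'rV[R]_n * 'rV[R]_n -> \bar R) (x xs mus : nat -> 'rV[R]_n) :
  eproper phi -> primal_feasible K.+1 F Q0 Q1 x ->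
  (dual_objective K.+1 F Q0 Q1 phi xs mus <= primal_objective K.+1 phi x)%E.
Proof.
move=> [phiNy _] [Fx Q0x Q1x]; rewrite /dual_objective /primal_objective /=.
case phix : (phi (x K, x K.+1)) => [r||]; last 2 first.
- exact: leey.
- by have := phiNy (x K, x K.+1); rewrite phix.
have W0 : ((dot (x 0%N) (xs 0%N - mus 0%N))%:E <= W_ Q0 (xs 0%N - mus 0%N))%E.
  by apply: ereal_sup_ubound; exists (x 0%N).
have W1 : ((dot (x 1%N) (xs 1%N))%:E <= W_ Q1 (xs 1%N))%E.
  by apply: ereal_sup_ubound; exists (x 1%N).
have conj : (- conjugate phi (mus K - xs K)%R (- xs K.+1)%R <=
    - (dot (x K) (mus K - xs K) + dot (x K.+1) (- xs K.+1) - r)%:E)%E.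
  rewrite leeN2; apply: ereal_sup_ubound.
  by exists (x K, x K.+1) => //; rewrite phix.
have sumM : (\sum_(0 <= t < K) M_ (F t) (xs t - mus t)%R (mus t.+1) (xs t.+2) <=
    \sum_(0 <= t < K) (dot (x t) (xs t - mus t) + dot (x t.+1) (mus t.+1)
                       - dot (x t.+2) (xs t.+2))%:E)%E.
  rewrite big_nat [leRHS]big_nat; apply: lee_sum => t /= tK.
  by apply: ereal_inf_lbound; exists (x t, x t.+1, x t.+2) => //; exact: Fx.
apply: le_trans (leeB (leeB (leeD conj sumM) W0) W1) _.
rewrite sumEFin -!EFinN -!EFinD lee_fin.
have := coupling_blocks K xs mus x (fun t => x t.+1) x.
rewrite /coupling big1; last by move=> t _; rewrite subrr dot0l.
rewrite big1; last by move=> t _; rewrite subrr dot0l.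
by rewrite subrr dot0l !dotBr dotNr; lra.
Qed.

(** Membership in the domain of the decoupled problem: the set constraints without
the equations that tie the copies together. *)
Definition splitting (R : realType) (n K : nat)
    (F : nat -> 'rV[R]_n -> 'rV[R]_n -> set 'rV[R]_n) (Q0 Q1 : set 'rV[R]_n)
    (phi : 'rV[R]_n * 'rV[R]_n -> \bar R) (a b c : nat -> 'rV[R]_n) : Prop :=
  [/\ forall t, (t < K)%N -> F t (a t) (b t) (c t.+2), Q0 (c 0%N), Q1 (c 1%N) &
      edom phi (a K, a K.+1)].

(** The Lagrangian separates, so each block can be minimized while the others are
kept fixed. The blocks are treated in turn, the graphs first; each extremum is
shown to be finite before the next is taken. *)
Lemma dual_objective_ge (R : realType) (n K : nat)
    (F : nat -> 'rV[R]_n -> 'rV[R]_n -> set 'rV[R]_n) (Q0 Q1 : set 'rV[R]_n)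
    (phi : 'rV[R]_n * 'rV[R]_n -> \bar R) (alpha : R)
    (xs mus a0 b0 c0 : nat -> 'rV[R]_n) :
  eproper phi -> splitting K F Q0 Q1 phi a0 b0 c0 -> mus 0%N = 0 ->
  (forall a b c, splitting K F Q0 Q1 phi a b c ->
    alpha <= fine (phi (a K, a K.+1)) + coupling K xs mus a b c) ->
  (alpha%:E <= dual_objective K.+1 F Q0 Q1 phi xs mus)%E.
Proof.
move=> [phiNy _] [F0 Q00 Q10 phi0] mus0 lagr; rewrite /dual_objective /=.
have fin_phi p : edom phi p -> phi p = (fine (phi p))%:E.
  by move=> dp; rewrite fineK// fin_numElt ltNye phiNy.
set M := (\sum_(0 <= t < K) _)%E.
have blocks p q0 q1 : edom phi p -> Q0 q0 -> Q1 q1 -> exists2 m, M = m%:E &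
    alpha <= fine (phi p) + dot p.1 (xs K - mus K) + dot p.2 (xs K.+1) + m
             - dot q0 (xs 0%N - mus 0%N) - dot q1 (xs 1%N).
  move=> phip Q0q Q1q; pose gamma := alpha - (fine (phi p)
    + dot p.1 (xs K - mus K) + dot p.2 (xs K.+1)
    - dot q0 (xs 0%N - mus 0%N) - dot q1 (xs 1%N)).
  have [|g Gg|m Mm gm] := @sum_ereal_inf_ge R nat _ (index_iota 0 K)
      (fun t => gph (F t)) (fun t g => dot g.1.1 (xs t - mus t)
        + dot g.1.2 (mus t.+1) - dot g.2 (xs t.+2))
      (fun t => (a0 t, b0 t, c0 t.+2)) gamma (iota_uniq _ _).
  - by move=> t; rewrite mem_index_iota => /= tK; exact: F0.
  - (* The splitting whose blocks are the given independent points. *)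
    pose a t := if (t < K)%N then (g t).1.1 else if t == K then p.1 else p.2.
    pose b t := (g t).1.2.
    pose c t := match t with 0%N => q0 | 1%N => q1 | t.+2 => (g t).2 end.
    have aK : a K = p.1 by rewrite /a ltnn eqxx.
    have aK1 : a K.+1 = p.2 by rewrite /a ltnNge leqnSn /= gtn_eqF.
    have mu0 : dot (a 0%N - c 0%N) (mus 0%N) = 0 by rewrite mus0 dotC dot0l.
    have := lagr a b c; have := coupling_blocks K xs mus a b c.
    rewrite mu0 subr0 => ->; rewrite aK aK1 -surjective_pairing /gamma.
    rewrite (@eq_big_nat _ _ _ _ _ _ (fun t => dot (g t).1.1 (xs t - mus t)
        + dot (g t).1.2 (mus t.+1) - dot (g t).2 (xs t.+2))); last first.
      by move=> t /= tK; rewrite /a tK.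
    move=> lagr_abc; suff /lagr_abc : splitting K F Q0 Q1 phi a b c by lra.
    split; rewrite ?aK ?aK1 -?surjective_pairing// => t tK.
    by rewrite /a tK; apply: Gg; rewrite mem_index_iota.
  - by exists m => //; move: gm; rewrite /gamma; lra.
have [m Mm _] := blocks _ _ _ phi0 Q00 Q10.
have {}blocks p q0 q1 : edom phi p -> Q0 q0 -> Q1 q1 ->
    alpha <= fine (phi p) + dot p.1 (xs K - mus K) + dot p.2 (xs K.+1) + m
             - dot q0 (xs 0%N - mus 0%N) - dot q1 (xs 1%N).
  move=> dp Q0q Q1q; have [m'] := blocks _ _ _ dp Q0q Q1q.
  by rewrite Mm => -[<-].
have conj_le q0 q1 : Q0 q0 -> Q1 q1 ->
    (conjugate phi (mus K - xs K)%R (- xs K.+1)%R <=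
     (m - dot q0 (xs 0%N - mus 0%N) - dot q1 (xs 1%N) - alpha)%:E)%E.
  move=> Q0q Q1q; apply: ge_ereal_sup => _ [p _ <-].
  case: (ltP (phi p) +oo%E) => [dp|]; last first.
    by rewrite leye_eq => /eqP ->; rewrite addeNy leNye.
  rewrite fin_phi// -EFinB lee_fin.
  by have := blocks _ _ _ dp Q0q Q1q; rewrite !dotBr dotNr; lra.
have [k conjk] : exists k, conjugate phi (mus K - xs K) (- xs K.+1) = k%:E.
  apply: fin_between (conj_le _ _ Q00 Q10); apply: ereal_sup_ubound.
  by exists (a0 K, a0 K.+1) => //; rewrite fin_phi// -EFinB.
rewrite conjk in conj_le *.
have W0_le q1 : Q1 q1 -> (W_ Q0 (xs 0%N - mus 0%N)%R <=
    (m - k - dot q1 (xs 1%N) - alpha)%:E)%E.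
  move=> Q1q; apply: ge_ereal_sup => _ [q0 Q0q <-].
  by have := conj_le _ _ Q0q Q1q; rewrite !lee_fin; lra.
have [w0 W0w] : exists w, W_ Q0 (xs 0%N - mus 0%N)%R = w%:E.
  by apply: fin_between (W0_le _ Q10); apply: ereal_sup_ubound; exists (c0 0%N).
rewrite W0w in W0_le *.
have W1_le : (W_ Q1 (xs 1%N) <= (m - k - w0 - alpha)%:E)%E.
  apply: ge_ereal_sup => _ [q1 Q1q <-].
  by have := W0_le _ Q1q; rewrite !lee_fin; lra.
have [w1 W1w] : exists w, W_ Q1 (xs 1%N) = w%:E.
  by apply: fin_between W1_le; apply: ereal_sup_ubound; exists (c0 1%N).
by move: W1_le; rewrite W1w Mm -!EFinN -!EFinD !lee_fin; lra.
Qed.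
(** * Nondegeneracy as a constraint qualification *)

Lemma convex_set_comb (R : realType) (E : lmodType R) (A : set E) (p q : E)
    (t : R) :
  convex_set A -> 0 < t -> t < 1 -> A p -> A q -> A (t *: p + (1 - t) *: q).
Proof.
move=> cA t0 t1 Ap Aq.
by have := cA p q (Itv01 (ltW t0) (ltW t1)); rewrite !inE; apply.
Qed.

Lemma cvg_ray (R : realType) (E : normedModType R) (x v : E) :
  x + e *: v @[e --> (0 : R)^'+] --> x.
Proof.
apply: cvg_at_right_filter; rewrite -[X in _ --> X]addr0 -[X in _ + X](scale0r v).
by apply: cvgD; [exact: cvg_cst | exact: scalel_continuous].
Qed.

Lemma interior_ray (R : realType) (E : normedModType R) (C : set E) (x v : E) :
  interior C x -> \forall e \near (0 : R)^'+, C (x + e *: v).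
Proof. by move=> Cx; exact: (@cvg_ray R E x v _ Cx). Qed.

(** The point [x + e (x - d)] is the affine combination of [x] and [d] with
coefficients [1 + e] and [- e]. *)
Lemma relint_ray (R : realType) (E : normedModType R) (C : set E) (x d : E) :
  relint C x -> C d -> \forall e \near (0 : R)^'+, C (x + e *: (x - d)).
Proof.
move=> [Cx nCx] Cd.
have : \forall e \near (0 : R)^'+,
    affine_hull C (x + e *: (x - d)) -> C (x + e *: (x - d)).
  exact: (@cvg_ray R E x (x - d) _ nCx).
apply: filterS => e; apply.
exists 2%N, (fun i => if i == 0 then 1 + e else - e),
  (fun i => if i == 0 then x else d); split.
- by rewrite !big_ord_recl big_ord0 /=; lra.
- by move=> i; case: ifP.
- by rewrite !big_ord_recl big_ord0 /= addr0 scalerDl scale1r scalerBr scaleNr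
    addrA.
Qed.

Lemma interior_edom (R : realType) (E : normedModType R) (f : E -> \bar R)
    (p : E) :
  edom f p -> {for p, continuous f} -> interior (edom f) p.
Proof. by move=> fp fc; exact: (fc _ (open_ereal_lt' fp)). Qed.

Lemma near_splitting (R : realType) (n K : nat)
    (F : nat -> 'rV[R]_n -> 'rV[R]_n -> set 'rV[R]_n) (Q0 Q1 : set 'rV[R]_n)
    (phi : 'rV[R]_n * 'rV[R]_n -> \bar R) (x z a b c : nat -> 'rV[R]_n) :
  (forall t, (t < K)%N -> \forall e \near (0 : R)^'+,
    gph (F t) ((x t, x t.+1, x t.+2)
      + e *: ((z t, z t.+1, z t.+2) - (a t, b t, c t.+2)))) ->
  (\forall e \near (0 : R)^'+, Q0 (x 0%N + e *: (z 0%N - c 0%N))) ->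
  (\forall e \near (0 : R)^'+, Q1 (x 1%N + e *: (z 1%N - c 1%N))) ->
  (\forall e \near (0 : R)^'+, edom phi ((x K, x K.+1)
      + e *: ((z K, z K.+1) - (a K, a K.+1)))) ->
  \forall e \near (0 : R)^'+, splitting K F Q0 Q1 phi
    (fun t => x t + e *: (z t - a t)) (fun t => x t.+1 + e *: (z t.+1 - b t))
    (fun t => x t + e *: (z t - c t)).
Proof.
move=> nF nQ0 nQ1 nphi.
have {}nF : \forall e \near (0 : R)^'+, forall t : 'I_K,
    gph (F t) ((x t, x t.+1, x t.+2)
      + e *: ((z t, z t.+1, z t.+2) - (a t, b t, c t.+2))).
  by apply: filter_forall => t; exact: nF.
near=> e; split.
- move=> t tK.
  have : forall t : 'I_K, gph (F t) ((x t, x t.+1, x t.+2)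
      + e *: ((z t, z t.+1, z t.+2) - (a t, b t, c t.+2))) by near: e.
  by move=> /(_ (Ordinal tK)).
- by near: e.
- by near: e.
- by near: e.
Unshelve. all: by end_near. Qed.

(** The nondegenerate trajectory can be pushed away from any splitting [(a, b, c)],
up to a trajectory [z]: adding [e] times [(a, b, c)] to the pushed splitting gives
the trajectory [x + e z], so the pushed splitting violates each equation by [- e]
times what [(a, b, c)] does. *)
Lemma slater_direction (R : realType) (n K : nat)
    (F : nat -> 'rV[R]_n -> 'rV[R]_n -> set 'rV[R]_n) (Q0 Q1 : set 'rV[R]_n)
    (phi : 'rV[R]_n * 'rV[R]_n -> \bar R) :
  nondegeneracy K.+1 F Q0 Q1 phi ->
  exists2 x, splitting K F Q0 Q1 phi x (fun t => x t.+1) x &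
    forall a b c, splitting K F Q0 Q1 phi a b c ->
    exists z, \forall e \near (0 : R)^'+, splitting K F Q0 Q1 phi
      (fun t => x t + e *: (z t - a t)) (fun t => x t.+1 + e *: (z t.+1 - b t))
      (fun t => x t + e *: (z t - c t)).
Proof.
move=> [x [[Fx Q0x Q1x phix]|[ex [[Fx Q0x Q1x] iF iQ0 iQ1 [phix cphi]]]]].
  exists x; first by split=> [t /Fx[]|||]; [|case: Q0x|case: Q1x|case: phix].
  move=> a b c [Fd Q0d Q1d phid]; exists x; apply: near_splitting.
  - by move=> t tK; apply: relint_ray; [exact: Fx | exact: Fd].
  - exact: relint_ray.
  - exact: relint_ray.
  - exact: relint_ray.
exists x => // a b c [Fd Q0d Q1d phid].
(* A trajectory through the point of the exempted graph given by a, b and c. *)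
pose zG t0 t := if t == t0 then a t0 else if t == t0.+1 then b t0 else c t.
have [z [zF z0 z1]] : exists z : nat -> 'rV[R]_n,
    [/\ forall t, ex = Graph t -> (z t, z t.+1, z t.+2) = (a t, b t, c t.+2),
        ex = InitialQ0 -> z 0%N = c 0%N & ex = InitialQ1 -> z 1%N = c 1%N].
  case: ex {iF iQ0 iQ1} => [||t0]; [by exists c..|exists (zG t0)].
  split=> // _ [<-]; rewrite /zG !eqxx !gtn_eqF//.
exists z; apply: near_splitting.
- move=> t tK; have [et|et] := pselect (ex = Graph t).
    rewrite zF// subrr; apply: nearW => e; rewrite scaler0 addr0; exact: Fx.
  by apply: interior_ray; exact: iF.
- have [et|et] := pselect (ex = InitialQ0); last exact: interior_ray (iQ0 et).
  by rewrite z0// subrr; apply: nearW => e; rewrite scaler0 addr0.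
- have [et|et] := pselect (ex = InitialQ1); last exact: interior_ray (iQ1 et).
  by rewrite z1// subrr; apply: nearW => e; rewrite scaler0 addr0.
- by apply: interior_ray; exact: interior_edom.
Qed.

(** * Existence of the dual variables *)

Lemma extend_ord (T : Type) (m : nat) (u : 'I_m -> T) (d : T) :
  exists v : nat -> T, forall i : 'I_m, v i = u i.
Proof.
by exists (fun t => if insub t is Some i then u i else d) => i; rewrite valK.
Qed.

(** Scalar multipliers, one for each coordinate of each vector equation, assembled
into vector multipliers. *)
Lemma sum_mul_dot (R : realType) (m n : nat) (c : 'I_m * 'I_n -> R)
    (u : 'I_m -> 'rV[R]_n) (v : nat -> 'rV[R]_n) :
  (forall i : 'I_m, v i = \row_j c (i, j)) ->
  \sum_k c k * u k.1 0 k.2 = \sum_(i < m) dot (u i) (v i).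
Proof.
move=> vE; rewrite (eq_bigr (fun k => c (k.1, k.2) * u k.1 0 k.2)); last by case.
rewrite -(pair_bigA _ (fun i j => c (i, j) * u i 0 j)).
apply: eq_bigr => i _; apply: eq_bigr => j _.
by rewrite vE mxE mulrC.
Qed.

(** The multiplier lemma for the equations [a t = c t] and [b t = a t.+1] read
coordinatewise. On the domain these equations single out the feasible trajectories,
where the objective is at least [alpha]. *)
Lemma saddle_multipliers (R : realType) (n K : nat)
    (F : nat -> 'rV[R]_n -> 'rV[R]_n -> set 'rV[R]_n) (Q0 Q1 : set 'rV[R]_n)
    (phi : 'rV[R]_n * 'rV[R]_n -> \bar R) (alpha : R) :
  (forall t, (t < K)%N -> convex_mapping (F t)) -> convex_set Q0 ->
  convex_set Q1 -> eproper phi -> econvex phi ->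
  nondegeneracy K.+1 F Q0 Q1 phi ->
  (forall x, primal_feasible K.+1 F Q0 Q1 x ->
    (alpha%:E <= phi (x K, x K.+1))%E) ->
  exists xs mus : nat -> 'rV[R]_n, mus 0%N = 0 /\
    forall a b c, splitting K F Q0 Q1 phi a b c ->
      alpha <= fine (phi (a K, a K.+1)) + coupling K xs mus a b c.
Proof.
move=> cF cQ0 cQ1 [phiNy _] cphi /slater_direction[x _ slater] alpha_le.
have fin_phi p : edom phi p -> phi p = (fine (phi p))%:E.
  by move=> dp; rewrite fineK// fin_numElt ltNye phiNy.
pose E : lmodType R :=
  ((nat -> 'rV[R]_n) * (nat -> 'rV[R]_n) * (nat -> 'rV[R]_n))%type.
pose D : set E := [set w | splitting K F Q0 Q1 phi w.1.1 w.1.2 w.2].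
pose f (w : E) := fine (phi (w.1.1 K, w.1.1 K.+1)).
pose I : finType := ('I_K.+2 * 'I_n + 'I_K * 'I_n)%type.
(* Index k.1 is the time of the equation, k.2 its coordinate. *)
pose g (i : I) (w : E) : R := match i with
  | inl k => (w.1.1 k.1 - w.2 k.1) 0 k.2
  | inr k => (w.1.2 k.1 - w.1.1 k.1.+1) 0 k.2
  end.
have gL i : scalar (g i).
  by case: i => k r v w; rewrite /g /= !mxE; ring.
have fD : convex_on D f.
  move=> p q t [Fp Q0p Q1p phip] [Fq Q0q Q1q phiq] t0 t1.
  set m := t *: p + (1 - t) *: q.
  have mE k : [/\ m.1.1 k = t *: p.1.1 k + (1 - t) *: q.1.1 k,
      m.1.2 k = t *: p.1.2 k + (1 - t) *: q.1.2 k &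
      m.2 k = t *: p.2 k + (1 - t) *: q.2 k] by [].
  clearbody m; rewrite /f.
  have := cphi (p.1.1 K, p.1.1 K.+1) (q.1.1 K, q.1.1 K.+1) t t0 t1.
  rewrite (fin_phi _ phip) (fin_phi _ phiq) -!EFinM -EFinD.
  rewrite -[X in phi X]/(t *: p.1.1 K + (1 - t) *: q.1.1 K,
                         t *: p.1.1 K.+1 + (1 - t) *: q.1.1 K.+1).
  have [<- _ _] := mE K; have [<- _ _] := mE K.+1 => phi_le.
  have phim : edom phi (m.1.1 K, m.1.1 K.+1).
    by apply: le_lt_trans phi_le _; rewrite ltry.
  split; last by move: phi_le; rewrite (fin_phi _ phim) lee_fin.
  split=> //.
  - move=> s sK; have [-> -> _] := mE s; have [_ _ ->] := mE s.+2.
    exact: (convex_set_comb (p := (p.1.1 s, p.1.2 s, p.2 s.+2))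
      (q := (q.1.1 s, q.1.2 s, q.2 s.+2)) (cF s sK) t0 t1 (Fp s sK) (Fq s sK)).
  - by have [_ _ ->] := mE 0%N; exact: convex_set_comb.
  - by have [_ _ ->] := mE 1%N; exact: convex_set_comb.
have cq d : D d -> exists (e : R) d', [/\ 0 < e, D d' &
    forall i, i \in index_enum I -> g i d' = - e * g i d].
  move=> /slater[z nz]; near (0 : R)^'+ => e.
  exists e, ((fun t => x t + e *: (z t - d.1.1 t)),
    (fun t => x t.+1 + e *: (z t.+1 - d.1.2 t)),
    (fun t => x t + e *: (z t - d.2 t))); split.
  - by near: e; exact: nbhs_right_gt.
  - by rewrite /D /=; near: e.
  - by move=> [k|k] _; rewrite /g /= !mxE; ring.
have [w [Fw Q0w Q1w phiw] gw|c f_ge] :=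
    multipliers (alpha := alpha) (index_enum_uniq I) gL fD cq.
  have ac t : (t < K.+2)%N -> w.1.1 t = w.2 t.
    move=> tK; apply/eqP; rewrite -subr_eq0; apply/eqP/rowP => j; rewrite [RHS]mxE.
    exact: (gw (inl (Ordinal tK, j)) (mem_index_enum _)).
  have ba t : (t < K)%N -> w.1.2 t = w.1.1 t.+1.
    move=> tK; apply/eqP; rewrite -subr_eq0; apply/eqP/rowP => j; rewrite [RHS]mxE.
    exact: (gw (inr (Ordinal tK, j)) (mem_index_enum _)).
  rewrite -lee_fin -fin_phi//; apply: alpha_le; split=> [t /= tK||].
  - by rewrite -ba// [w.1.1 t.+2]ac//; exact: Fw.
  - by rewrite ac.
  - by rewrite ac.
have [xs xsE] := extend_ord (fun i : 'I_K.+2 => \row_j c (inl (i, j))) 0.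
have [mus musE] := extend_ord (fun i : 'I_K => \row_j c (inr (i, j))) 0.
exists xs, (fun t => if t is t'.+1 then mus t' else 0); split=> // a b c' Dabc.
have := f_ge (a, b, c') Dabc; rewrite big_sumType /= /coupling.
rewrite (sum_mul_dot (fun t : 'I_K.+2 => a t - c' t) xsE).
by rewrite (sum_mul_dot (fun t : 'I_K => b t - a t.+1) musE).
Unshelve. all: by end_near. Qed.
(** * Duality *)

Theorem theorem3p2 (R : realType) (n N : nat) (hN : (2 <= N)%N)
    (F : nat -> 'rV[R]_n -> 'rV[R]_n -> set 'rV[R]_n)
    (hF : forall t, (t < N.-1)%N -> convex_mapping (F t))
    (Q0 Q1 : set 'rV[R]_n)
    (hQ0 : Q0 !=set0) (hQ1 : Q1 !=set0)
    (cQ0 : convex_set Q0) (cQ1 : convex_set Q1)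
    (phi : 'rV[R]_n * 'rV[R]_n -> \bar R)
    (phi_proper : eproper phi) (phi_convex : econvex phi) :
  let alpha := primal_value N F Q0 Q1 phi in
  let alpha' := dual_value N F Q0 Q1 phi in
  [/\ (alpha' <= alpha)%E,
      (forall x xs mus, primal_feasible N F Q0 Q1 x ->
        (dual_objective N F Q0 Q1 phi xs mus <= primal_objective N phi x)%E) &
      (nondegeneracy N F Q0 Q1 phi ->
        [/\ alpha = alpha',
            (alpha \is a fin_num <-> alpha' \is a fin_num),
            ((exists x, primal_solution N F Q0 Q1 phi x) ->
              exists xs mus, dual_solution N F Q0 Q1 phi xs mus) &
            ((-oo < alpha)%E ->
              exists xs mus, dual_solution N F Q0 Q1 phi xs mus)])].
Proof.
case: N hN hF => [//|K] _ hF alpha alpha'.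
have weak x xs mus : primal_feasible K.+1 F Q0 Q1 x ->
    (dual_objective K.+1 F Q0 Q1 phi xs mus <= primal_objective K.+1 phi x)%E.
  exact: dual_le_primal.
have le_alpha : (alpha' <= alpha)%E.
  apply: ge_ereal_sup => _ [d _ <-]; apply: le_ereal_inf_tmp => _ [x Fx <-].
  exact: weak.
split=> // nd.
have [x slater _] := slater_direction nd; have [Fx Q0x Q1x phix] := slater.
have alpha_lty : (alpha < +oo)%E.
  by apply: le_lt_trans phix; apply: ereal_inf_lbound; exists x.
have strong : (-oo < alpha)%E -> exists xs mus,
    (alpha <= dual_objective K.+1 F Q0 Q1 phi xs mus)%E.
  move=> alphaNy; have fin_alpha : alpha = (fine alpha)%:E.
    by rewrite fineK// fin_numElt alphaNy.
  have alpha_le y : primal_feasible K.+1 F Q0 Q1 y ->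
      ((fine alpha)%:E <= phi (y K, y K.+1))%E.
    by move=> Fy; rewrite -fin_alpha; apply: ereal_inf_lbound; exists y.
  have [xs [mus [mus0 lagr]]] :=
    saddle_multipliers hF cQ0 cQ1 phi_proper phi_convex nd alpha_le.
  exists xs, mus; rewrite fin_alpha.
  exact: (dual_objective_ge phi_proper slater mus0 lagr).
have dual_le xs mus : (dual_objective K.+1 F Q0 Q1 phi xs mus <= alpha')%E.
  by apply: ereal_sup_ubound; exists (xs, mus).
have eq_alpha : alpha = alpha'.
  apply/eqP; rewrite eq_le le_alpha andbT.
  have [->|alphaNy] := eqVneq alpha -oo%E; first exact: leNye.
  have [|xs [mus /le_trans]] := strong; first by rewrite ltNye.
  by apply; exact: dual_le.
have attained : (-oo < alpha)%E ->
    exists xs mus, dual_solution K.+1 F Q0 Q1 phi xs mus.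
  move=> alphaNy; have [xs [mus alpha_ge]] := strong alphaNy.
  exists xs, mus; split; last by rewrite -/alpha' -eq_alpha fin_numElt alphaNy.
  by apply/eqP; rewrite eq_le dual_le -/alpha' -eq_alpha.
split=> //; first by rewrite eq_alpha.
by move=> [y [_ _]]; rewrite fin_numElt => /andP[/attained].
Qed.
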